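(* Let $H$ be a Hilbert space, $X\colon\mathbb R_{\ge0}\to H$ a càdlàg path and $(\pi_n)$ a sequence of partitions of $\mathbb R_{\ge 0}$. If $X$ has weak projective tensor quadratic variation $[X,X]$ along $(\pi_n)$, then $X$ has the scalar quadratic variation $Q(X)$ along $(\pi_n)$, given by $Q(X)_t=\operatorname{tr}_H([X,X]_t)$ for all $t\ge0$.
   Context: All spaces are real. A partition of $\mathbb R_{\ge0}$ is a set $\pi=\{\,]t_i,t_{i+1}] : i\in\mathbb N\}$ with $0=t_0<t_1<\dots\to\infty$. A càdlàg path is a function on $\mathbb R_{\ge0}$ that is right-continuous at every $t\ge0$ and has a left limit at every $t>0$. For a càdlàg path $X$, $\Delta X_t=X_t-X_{t-}$, with $\Delta X_0=0$; for $I=]r,s]$, $\delta X_t(I)=X_{s\wedge t}-X_{r\wedge t}$. A path has finite variation if its total variation on each compact interval is finite. For Banach spaces $E,G$ and a bounded bilinear map $B\colon E\times E\to G$, a càdlàg $E$-valued path $X$ has weak $B$-quadratic variation along $(\pi_n)$ if there is a $G$-valued càdlàg path $Q_B(X,X)$ of finite variation such that, for every $t\ge0$, $\sum_{I\in\pi_n}B(\delta X_t(I),\delta X_t(I))\to Q_B(X,X)_t$ in the weak topology of $G$, and $\Delta Q_B(X,X)_t=B(\Delta X_t,\Delta X_t)$ for all $t\ge0$. The weak projective tensor quadratic variation $[X,X]$ of an $H$-valued path is the weak $B$-quadratic variation for the canonical bilinear map $B=\otimes\colon H\times H\to H\widehat\otimes H$, where $H\widehat\otimes H$ is the completed projective tensor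 product. The trace $\operatorname{tr}_H\colon H\widehat\otimes H\to\mathbb R$ is the unique continuous linear form with $\operatorname{tr}_H(x\otimes y)=\langle x,y\rangle_H$ for all $x,y\in H$. A càdlàg path $X$ in a Banach space has scalar quadratic variation along $(\pi_n)$ if there is a real-valued càdlàg increasing path $Q(X)$ such that $\sum_{I\in\pi_n}\|\delta X_t(I)\|^2\to Q(X)_t$ for every $t\ge0$ and $\Delta Q(X)_t=\|\Delta X_t\|^2$ for all $t\ge0$; then $Q(X)$ is called the scalar quadratic variation of $X$ along $(\pi_n)$.
   Formalization: For arbitrary partitions the trace path is shown to be càdlàg, the limit of the scalar sums, with the right jumps; that it is increasing, which can fail in general, is claimed only when the mesh of the partitions vanishes on compact intervals. *)

(* Defs.v *)
From HB Require Import structures.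
From mathcomp Require Import all_boot all_order all_algebra.
From mathcomp Require Import sesquilinear.
From mathcomp Require Import all_classical all_reals topology normedtype.
From mathcomp Require Import sequences numfun.

Set Implicit Arguments.
Unset Strict Implicit.
Unset Printing Implicit Defensive.

Import Order.TTheory GRing.Theory Num.Theory.
Import numFieldNormedType.Exports.

Local Open Scope classical_set_scope.
Local Open Scope ring_scope.

(* A path on the half-line is a function on R of which only the values at
   t >= 0 matter. *)
Section Paths.
Context {R : realType} {E : normedModType R}.
Implicit Types X : R -> E.

Definition cadlag X :=
  (forall t, 0 <= t -> X x @[x --> t^'+] --> X t) /\
  (forall t, 0 < t -> cvg (X x @[x --> t^'-])).

Definition jump X t : E :=
  if 0 < t then X t - lim (X x @[x --> t^'-]) else 0.

(* Vector-valued analogue of bounded_variation. *)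
Definition variation_sum (a b : R) X (s : seq R) : R :=
  let F := X \o nth b (a :: s) in
  \sum_(0 <= i < size s) `|F i.+1 - F i|.

Definition finite_variation X :=
  forall a b : R, 0 <= a -> a <= b ->
    has_ubound [set variation_sum a b X s | s in [set s | itv_partition a b s]].

End Paths.

Definition nondecreasing_path {R : realType} (q : R -> R) :=
  forall s t, 0 <= s -> s <= t -> q s <= q t.

(* The partition { ]t_i, t_{i+1}] : i in nat } is given by its sequence of
   endpoints, which determines it and is determined by it. *)
Record time_partition (R : realType) := TimePartition {
  endpoint :> nat -> R ;
  endpoint0 : endpoint 0%N = 0 ;
  endpoint_lt : forall i, endpoint i < endpoint i.+1 ;
  endpoint_oo : endpoint i @[i --> \oo] --> +oo }.

Definition increment {R : realType} {E : normedModType R} (p : time_partition R)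
    (X : R -> E) (t : R) (i : nat) : E :=
  X (Num.min (p i.+1) t) - X (Num.min (p i) t).

(* In the two sums below all but finitely many terms vanish. *)
Definition quadratic_sum {R : realType} {E G : normedModType R}
    (B : E -> E -> G) (p : time_partition R) (X : R -> E) (t : R) : G :=
  limn (series (fun i => B (increment p X t i) (increment p X t i))).

Definition scalar_quadratic_sum {R : realType} {E : normedModType R}
    (p : time_partition R) (X : R -> E) (t : R) : R :=
  limn (series (fun i => `|increment p X t i| ^+ 2)).

(* Without this condition the limit of the scalar sums can fail to be
   increasing: for X_t = max(0, 1 - |t - 1|) in the real line and the constant
   sequence of partitions with endpoints 0, 3, 6, ... the sums equal X_t ^ 2. *)
Definition locally_vanishing_mesh {R : realType} (pn : nat -> time_partition R) :=
  forall T e : R, 0 < e ->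
    \forall n \near \oo, forall i, pn n i <= T -> pn n i.+1 - pn n i < e.

(* G with its weak topology, the initial topology for its continuous linear
   forms *)
Definition weak_space {R : realType} (G : normedModType R) : topologicalType :=
  @sup_topology G {f : {linear G -> R^o} | continuous f}
    (fun f => Topological.class (initial_topology (projT1 f))).

Section QuadraticVariation.
Context {R : realType}.

Record weak_quadratic_variation {E G : completeNormedModType R}
    (B : {bilinear E -> E -> G}) (pn : nat -> time_partition R) (X : R -> E)
    (Q : R -> G) : Prop := WeakQuadraticVariation {
  wqv_cadlag : cadlag Q ;
  wqv_finite_variation : finite_variation Q ;
  wqv_cvg : forall t, 0 <= t ->
    (fun n => quadratic_sum B (pn n) X t : weak_space G) @ \oo
      --> (Q t : weak_space G) ;
  wqv_jump : forall t, 0 <= t -> jump Q t = B (jump X t) (jump X t) }.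

Record scalar_quadratic_limit {E : completeNormedModType R}
    (pn : nat -> time_partition R) (X : R -> E) (q : R -> R) : Prop :=
  ScalarQuadraticLimit {
  sql_cadlag : cadlag (q : R -> R^o) ;
  sql_cvg : forall t, 0 <= t ->
    (fun n => scalar_quadratic_sum (pn n) X t) @ \oo --> q t ;
  sql_jump : forall t, 0 <= t -> jump (q : R -> R^o) t = `|jump X t| ^+ 2 }.

Definition scalar_quadratic_variation {E : completeNormedModType R}
    (pn : nat -> time_partition R) (X : R -> E) (q : R -> R) : Prop :=
  scalar_quadratic_limit pn X q /\ nondecreasing_path q.

End QuadraticVariation.

Section ProjectiveTensorProduct.
Context {R : realType} {E F : normedModType R}.

(* The list [:: (x_1, y_1); ...; (x_k, y_k)] stands for the element
   x_1 (x) y_1 + ... + x_k (x) y_k of the algebraic tensor product of E and F,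
   which is the quotient of the lists by the following congruence. *)
Inductive tensor_eq : seq (E * F) -> seq (E * F) -> Prop :=
| tensor_eq_refl u : tensor_eq u u
| tensor_eq_sym u v : tensor_eq u v -> tensor_eq v u
| tensor_eq_trans u v w : tensor_eq u v -> tensor_eq v w -> tensor_eq u w
| tensor_eq_cat u u' v v' :
    tensor_eq u u' -> tensor_eq v v' -> tensor_eq (u ++ v) (u' ++ v')
| tensor_eq_catC u v : tensor_eq (u ++ v) (v ++ u)
| tensor_eq_zero y : tensor_eq [:: (0, y)] [::]
| tensor_eq_addl x x' y : tensor_eq [:: (x + x', y)] [:: (x, y); (x', y)]
| tensor_eq_addr x y y' : tensor_eq [:: (x, y + y')] [:: (x, y); (x, y')]
| tensor_eq_scale (a : R) x y : tensor_eq [:: (a *: x, y)] [:: (x, a *: y)].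

Definition projective_norm (u : seq (E * F)) : R :=
  inf [set \sum_(p <- v) `|p.1| * `|p.2| | v in tensor_eq u].

(* (G, tens) is a completion of the algebraic tensor product for the
   projective norm; since G is complete, this determines it up to a unique
   isometric isomorphism. *)
Record completed_projective_tensor {G : completeNormedModType R}
    (tens : {bilinear E -> F -> G}) : Prop := CompletedProjectiveTensor {
  cpt_norm : forall u,
    `|\sum_(p <- u) tens p.1 p.2| = projective_norm u ;
  cpt_dense : dense (range (fun u : seq (E * F) =>
    \sum_(p <- u) tens p.1 p.2)) }.

End ProjectiveTensorProduct.

(* The continuous linear form below exists and is unique whenever tens is a
   completed projective tensor product and dot induces the norm. *)
Definition tensor_trace {R : realType} {H : normedModType R}
    (dot : {dot H for idfun}) {G : completeNormedModType R}
    (tens : {bilinear H -> H -> G}) : G -> R :=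
  get [set f : G -> R | [/\ scalar f, continuous f &
                            forall x y, f (tens x y) = dot x y]].

(* Main.v *)
(* The inner product is a contraction from the algebraic tensor product with
   its projective norm (Cauchy-Schwarz), so it extends to a continuous linear
   form tr on the completion. Applying tr to the weakly convergent tensor sums
   gives the scalar sums, since tr (x (x) x) = |x|^2, and tr preserves left and
   right limits, hence jumps.
   For s < t, the sum at s exceeds the sum at t by at most the contribution of
   the interval ]r, u] that contains s, which is bounded by
   2 |X_s - X_r| |X_(min u t) - X_s|. When the mesh vanishes the first factor
   stays bounded (left limit at s) and the second tends to 0 (right continuity
   at s), so the limit is nondecreasing. *)

From HB Require Import structures.
Require Import Defs.
From mathcomp Require Import all_boot all_order all_algebra.
From mathcomp Require Import sesquilinear.
From mathcomp Require Import all_classical all_reals topology normedtype.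
From mathcomp Require Import sequences ring lra.

Import Order.TTheory GRing.Theory Num.Theory.
Import numFieldNormedType.Exports.

Local Open Scope classical_set_scope.
Local Open Scope ring_scope.

(** * The trace as a contractive linear form on the completed tensor product *)

Section Trace.
Context {R : realType}.

Lemma dense_approx (G : normedModType R) (A : set G) (g : G) (e : R) :
  dense A -> 0 < e -> exists2 x, A x & `|g - x| < e.
Proof.
move=> dA e0; have [||x [gx Ax]] := dA (ball g e).
- by exists g; exact: ballxx.
- exact: ball_open.
- by exists x => //; move: gx; rewrite -ball_normE.
Qed.

(* McShane's formula: [f g = inf_i (D i + |g - S i|)]. *)
Lemma contraction_extension (G : normedModType R) (I : Type) (i0 : I)
    (S : I -> G) (D : I -> R) :
  (forall i j, `|D i - D j| <= `|S i - S j|) ->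
  exists f : G -> R, forall g i, `|f g - D i| <= `|g - S i|.
Proof.
move=> DS; pose A g := [set D i + `|g - S i| | i in [set: I]].
have A0 g : A g !=set0 by exists (D i0 + `|g - S i0|); exists i0.
have Alb g i : lbound (A g) (D i - `|g - S i|).
  move=> _ [j _ <-].
  rewrite lerBlDr -addrA -lerBlDl (le_trans (ler_norm _))//.
  rewrite (le_trans (DS i j))// [`|g - S j| + _]addrC (distrC g (S i)).
  exact: ler_distD.
exists (fun g => inf (A g)) => g i.
rewrite ler_distl lb_le_inf//= ge_inf//; first by exists (D i - `|g - S i|).
by exists i.
Qed.

(** [I] is a bare index type on which [comb a i j] stands for [a * i + j], so formal sums can serve
    as indices without passing to a quotient. *)
Lemma dense_linear_extension (G : normedModType R) (I : Type)
    (S : I -> G) (D : I -> R) (comb : R -> I -> I -> I) :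
    dense (range S) ->
    (forall a i j, S (comb a i j) = a *: S i + S j) ->
    (forall a i j, D (comb a i j) = a * D i + D j) ->
    (forall i, `|D i| <= `|S i|) ->
  exists f : G -> R,
    [/\ scalar f, forall g, `|f g| <= `|g| & forall i, f (S i) = D i].
Proof.
move=> dS SE DE DS.
have [_ [i0 _ _] _] := dense_approx _ _ 0 1 dS ltr01.
have [i j|f fD] := contraction_extension _ _ i0 S D.
  (* This index represents [S i - S j], so the norm bound becomes a Lipschitz bound; in particular
     [D i] depends only on [S i]. *)
  have := DS (comb (-1) j i).
  by rewrite SE DE scaleN1r mulN1r ![- _ + _]addrC.
have fS i : f (S i) = D i.
  by apply/eqP; rewrite -subr_eq0 -normr_le0 (le_trans (fD _ i))// subrr normr0.
exists f; split=> // [a g h|g].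
- apply/eqP; rewrite -subr_eq0 -normr_le0; apply/ler_addgt0Pl => e e0.
  (* The three errors below are at most [(|a| + 1) * d], [|a| * d] and [d], which add up to [e]. *)
  rewrite addr0; pose d := e / (2 * (`|a| + 1)).
  have a1 : 0 < `|a| + 1 by rewrite ltr_wpDl.
  have d0 : 0 < d by rewrite divr_gt0// mulr_gt0.
  have [_ [i _ <-] gi] := dense_approx _ _ g d dS d0.
  have [_ [j _ <-] hj] := dense_approx _ _ h d dS d0.
  have -> : f (a *: g + h) - (a * f g + f h) =
      (f (a *: g + h) - D (comb a i j)) - a * (f g - D i) - (f h - D j).
    by rewrite DE mulrBr; lra.
  have H1 : `|f (a *: g + h) - D (comb a i j)| <= (`|a| + 1) * d.
    rewrite (le_trans (fD _ _))// SE.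
    have -> : a *: g + h - (a *: S i + S j) = a *: (g - S i) + (h - S j).
      by rewrite scalerBr addrACA opprD.
    rewrite (le_trans (ler_normD _ _))// normrZ mulrDl mul1r.
    by apply: lerD; [apply: ler_wpM2l => //|]; exact: ltW.
  have H2 : `|a * (f g - D i)| <= `|a| * d.
    by rewrite normrM ler_wpM2l// (le_trans (fD _ _))// ltW.
  have H3 : `|f h - D j| <= d by rewrite (le_trans (fD _ _))// ltW.
  have -> : e = (`|a| + 1) * d + `|a| * d + d.
    rewrite -addrA -[X in _ + (_ + X)]mul1r -mulrDl -mulrDl /d.
    by field; rewrite gt_eqF.
  rewrite (le_trans (ler_normB _ _))// lerD//.
  by rewrite (le_trans (ler_normB _ _))// lerD.
- apply/ler_addgt0Pl => e e0.
  have e20 : 0 < e / 2 by rewrite divr_gt0.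
  have [_ [i _ <-] gi] := dense_approx _ _ g (e / 2) dS e20.
  have := fD g i; have := DS i.
  have : `|S i| <= `|S i - g| + `|g|.
    by rewrite (le_trans _ (ler_normD _ _))// subrK.
  have : `|f g| <= `|f g - D i| + `|D i|.
    by rewrite (le_trans _ (ler_normD _ _))// subrK.
  rewrite (distrC (S i)); lra.
Qed.

Context {H : normedModType R} (dot : {dot H for idfun}).
Hypothesis dotE : forall x : H, `|x| ^+ 2 = dot x x.

Lemma dotC x y : dot x y = dot y x.
Proof. by rewrite hermC expr0 mul1r. Qed.

(** Expanding [|u + v| ^+ 2] by [dotE] and comparing with [(|u| + |v|) ^+ 2] turns the triangle
    inequality into Cauchy-Schwarz. *)
Lemma dot_cauchy_schwarz x y : `|dot x y| <= `|x| * `|y|.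
Proof.
suff H1 u v : dot u v <= `|u| * `|v|.
  by rewrite ler_norml H1 lerNl -linearNl -(normrN x) H1.
have := dotE (u + v); rewrite linearDl /= !linearDr/= -!dotE (dotC v u).
have := ler_normD u v; have := normr_ge0 (u + v); nra.
Qed.

Context {G : completeNormedModType R} (tens : {bilinear H -> H -> G}).
Hypothesis tensP : completed_projective_tensor tens.

Let D (u : seq (H * H)) := \sum_(p <- u) dot p.1 p.2.

(** Each generating rule of the congruence preserves [D], which therefore descends to the algebraic
    tensor product. *)
Lemma tensor_eq_dot u v : tensor_eq u v -> D u = D v.
Proof.
rewrite /D; elim=> {u v} //.
- by move=> u v w _ -> _ ->.
- by move=> u u' v v' _ IHu _ IHv; rewrite !big_cat/= IHu IHv.
- by move=> u v; rewrite !big_cat/= addrC.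
- by move=> y; rewrite big_seq1 big_nil linear0l.
- by move=> x x' y; rewrite !big_cons !big_nil !addr0 linearDl.
- by move=> x y y'; rewrite !big_cons !big_nil !addr0 linearDr.
- by move=> a x y; rewrite !big_seq1 linearZl_LR linearZr_LR.
Qed.

Lemma dot_le_projective_norm u : `|D u| <= projective_norm u.
Proof.
apply: lb_le_inf => [|_ [v uv <-]].
  exists (\sum_(p <- u) `|p.1| * `|p.2|), u => //; exact: tensor_eq_refl.
rewrite (tensor_eq_dot _ _ uv) (le_trans (ler_norm_sum _ _ _))//.
by apply: ler_sum => p _; exact: dot_cauchy_schwarz.
Qed.

Lemma tensor_traceP : [/\ scalar (tensor_trace dot tens),
  continuous (tensor_trace dot tens)
  & forall x y, tensor_trace dot tens (tens x y) = dot x y].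
Proof.
suff /getPex : exists f, [set f : G -> R | [/\ scalar f, continuous f &
    forall x y, f (tens x y) = dot x y]] f by [].
pose S (u : seq (H * H)) := \sum_(p <- u) tens p.1 p.2.
(* On lists, scaling acts on the first factors and addition is concatenation. *)
pose comb (a : R) (u v : seq (H * H)) := [seq (a *: p.1, p.2) | p <- u] ++ v.
have [||||f [flin fle fS]] := dense_linear_extension _ _ S D comb.
- exact: cpt_dense tensP.
- move=> a u v; rewrite /S big_cat big_map/= scaler_sumr; congr (_ + _).
  by apply: eq_bigr => p _; rewrite linearZl_LR.
- move=> a u v; rewrite /D big_cat big_map/= mulr_sumr; congr (_ + _).
  by apply: eq_bigr => p _; rewrite linearZl_LR.
- by move=> u; rewrite (cpt_norm tensP) dot_le_projective_norm.
exists f; split=> // [|x y]; last first.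
  by have := fS [:: (x, y)]; rewrite /S /D !big_seq1.
move=> x; apply/cvgrPdist_lt => e e0; near=> y.
have -> : f x - f y = f (x - y).
  by rewrite addrC -mulN1r -flin scaleN1r addrC.
rewrite (le_lt_trans (fle _))//.
Unshelve. all: by end_near.
Qed.

End Trace.

Section WeakTopology.
Context {R : realType} {G : normedModType R}.

Lemma weak_space_cvg (f : {linear G -> R^o}) (T : Type) (F : set_system T)
    (u : T -> G) (l : G) : Filter F -> continuous f ->
  (u : T -> weak_space G) @ F --> (l : weak_space G) -> f \o u @ F --> f l.
Proof.
move=> FF cf ul.
have /cvg_sup /(_ (exist _ f cf)) ul' := ul.
apply: (cvg_comp _ _ ul').
exact: (@initial_continuous G R^o f l).
Qed.

End WeakTopology.

(** * Finiteness of the quadratic sums and their comparison at two times *)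

Section QuadraticSums.
Context {R : realType} {E : normedModType R}.
Implicit Types (p : time_partition R) (X : R -> E) (s t : R).

Lemma endpoint_nondecreasing p : {homo p : i j / (i <= j)%N >-> i <= j}.
Proof. by apply/nondecreasing_seqP => i; exact/ltW/endpoint_lt. Qed.

Lemma endpoint_ge0 p i : 0 <= p i.
Proof. by rewrite -(endpoint0 p) endpoint_nondecreasing. Qed.

Lemma increment_eq0 p X t i : t <= p i -> increment p X t i = 0.
Proof.
move=> tp; rewrite /increment !min_r ?subrr//.
by rewrite (le_trans tp)// ltW// endpoint_lt.
Qed.

(** The endpoints tend to infinity, so the partial sums become constant. Any index beyond [N] works,
    which lets two series be cut at the same place. *)
Lemma series_increment_finite (G : normedModType R) (b : E -> G) p X t :
  b 0 = 0 -> exists N, forall n, (N <= n)%N ->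
    t <= p n /\
    limn (series (fun i => b (increment p X t i))) =
    \sum_(0 <= i < n) b (increment p X t i).
Proof.
move=> b0; have /cvgryPge /(_ t) [N _ Nt] := endpoint_oo p.
exists N => n Nn; split; first exact: Nt.
apply: norm_lim_near_cst; exists n => // m /= nm.
rewrite /series /= (@big_cat_nat _ _ _ n)//= [X in _ + X]big_nat_cond.
rewrite [X in _ + X]big1 ?addr0// => i /andP[/andP[ni _] _].
by rewrite increment_eq0// Nt//= (leq_trans Nn).
Qed.

Lemma increment_sqr_sum_le p X s t c : 0 <= c -> s <= t ->
    (forall i, p i <= s -> s < p i.+1 ->
      `|increment p X s i| ^+ 2 <= `|increment p X t i| ^+ 2 + c) ->
  forall n, \sum_(0 <= i < n) `|increment p X s i| ^+ 2 <=
            \sum_(0 <= i < n) `|increment p X t i| ^+ 2 + c.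
Proof.
move=> c0 st sc n.
(* Induction with [c] charged only once [s] has been passed: up to [s] the increments agree, the
   interval around [s] costs [c], and later increments at [s] vanish. *)
suff : \sum_(0 <= i < n) `|increment p X s i| ^+ 2 <=
    \sum_(0 <= i < n) `|increment p X t i| ^+ 2 + (if s < p n then c else 0).
  by case: ifP => // _ /le_trans; apply; rewrite lerD2l.
elim: n => [|n IHn]; first by rewrite !big_nil add0r; case: ifP.
rewrite !big_nat_recr//=; move: IHn.
have [spn|pns] := ltP s (p n).
  rewrite (increment_eq0 _ _ s); last exact: ltW.
  rewrite normr0 expr0n/= addr0 (lt_trans spn (endpoint_lt p n)).
  by have := sqr_ge0 `|increment p X t n|; lra.
have [spn1|pns1] := ltP s (p n.+1).
  by have := sc n pns spn1; lra.
suff -> : increment p X s n = increment p X t n by lra.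
by rewrite /increment !min_l// (le_trans _ st).
Qed.

(** Write [b], [d], [a] for the norms of [y - x], [z - y], [z - x]. If [b <= d], then
    [b ^+ 2 <= 2 * b * d]; otherwise square [b - d <= a]. *)
Lemma sqr_norm_sub_le (x y z : E) :
  `|y - x| ^+ 2 <= `|z - x| ^+ 2 + 2 * `|y - x| * `|z - y|.
Proof.
have := ler_distD z y x; rewrite (distrC y z).
have := normr_ge0 (z - x); have := normr_ge0 (z - y); have := normr_ge0 (y - x).
move: (`|y - x|) (`|z - y|) (`|z - x|) => b d a b0 d0 a0 bda.
have [bd|db] := leP b d; first by nra.
have : (b - d) ^+ 2 <= a ^+ 2 by rewrite ler_sqr ?nnegrE; lra.
by nra.
Qed.

Lemma scalar_quadratic_sum_le p X s t c : 0 <= c -> s <= t ->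
    (forall i, p i <= s -> s < p i.+1 ->
      2 * `|X s - X (p i)| * `|X (Num.min (p i.+1) t) - X s| <= c) ->
  scalar_quadratic_sum p X s <= scalar_quadratic_sum p X t + c.
Proof.
move=> c0 st sc; rewrite /scalar_quadratic_sum.
have norm0 : `|0 : E| ^+ 2 = 0 by rewrite normr0 expr0n.
have [N1 h1] := series_increment_finite R^o (fun x => `|x| ^+ 2) p X s norm0.
have [N2 h2] := series_increment_finite R^o (fun x => `|x| ^+ 2) p X t norm0.
have [_ ->] := h1 (maxn N1 N2) (leq_maxl _ _).
have [_ ->] := h2 (maxn N1 N2) (leq_maxr _ _).
apply: increment_sqr_sum_le => // i pis spi.
rewrite /increment (min_r (ltW spi)) (min_l pis) (min_l (le_trans pis st)).
apply: le_trans (sqr_norm_sub_le _ _ (X (Num.min (p i.+1) t))) _.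
by rewrite lerD2l sc.
Qed.

Lemma cadlag_bounded_left X t : cadlag X -> 0 < t ->
  exists M, \forall x \near t^'-, `|X t - X x| <= M.
Proof.
move=> [_ Xl] t0; have /cvg_bounded [M [_ HM]] := Xl _ t0.
exists (`|X t| + (M + 1)).
have M1 : M < M + 1 by rewrite ltrDl.
by apply: filterS (HM _ M1) => x Hx; rewrite (le_trans (ler_normB _ _))// lerD2l.
Qed.

Lemma scalar_quadratic_sum_near_le (pn : nat -> time_partition R) X s t e :
    locally_vanishing_mesh pn -> cadlag X -> 0 <= s -> s < t -> 0 < e ->
  \forall n \near \oo, scalar_quadratic_sum (pn n) X s <=
                       scalar_quadratic_sum (pn n) X t + e.
Proof.
move=> mesh cX s0 st e0.
(* The bound must include [x = s], which the left filter omits, hence [Num.max M 0] below. At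
   [s = 0] there is no left limit, but [x = s] is the only case. *)
have [M [d d0 HM]] : exists M, exists2 d, 0 < d &
    forall x, 0 <= x -> s - d < x -> x <= s -> `|X s - X x| <= M.
  have [s_eq0|sn0] := eqVneq s 0.
    exists 0; exists 1 => // x x0 _ xs.
    have -> : x = s by apply/eqP; rewrite eq_le xs s_eq0.
    by rewrite subrr normr0.
  have [|M [d /= d0 Hd]] := cadlag_bounded_left X s cX; first by rewrite lt0r sn0.
  exists (Num.max M 0), d => // x _ dx; rewrite le_eqVlt => /predU1P[->|xs].
    by rewrite subrr normr0 le_max lexx orbT.
  rewrite le_max Hd//= /ball/= ger0_norm; first by lra.
  by rewrite subr_ge0 ltW.
have M0 : 0 <= M by rewrite (le_trans _ (HM s s0 _ _))//; lra.
(* This makes [2 * M * eta <= e]; the added 1 keeps the denominator positive when [M = 0]. *)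
pose eta := e / (2 * M + 1).
have eta0 : 0 < eta by rewrite divr_gt0//; lra.
have /cvgrPdist_lt /(_ _ eta0) [d' /= d'0 Hd'] := cX.1 s s0.
have m0 : 0 < Num.min d d' by rewrite lt_min d0.
(* With mesh below both radii, the interval containing [s] starts after [s - d] and ends before
   [s + d']. *)
apply: filterS (mesh s _ m0) => n Hn.
apply: scalar_quadratic_sum_le; [exact: ltW|exact: ltW|move=> i pis spi].
have := Hn i pis; rewrite lt_min => /andP[h1 h2].
have A1 : `|X s - X (pn n i)| <= M by apply: HM => //; [exact: endpoint_ge0|lra].
(* Strictness matters: the right filter at [s] omits [s] itself. *)
have su : s < Num.min (pn n i.+1) t by rewrite lt_min spi.
have A2 : `|X (Num.min (pn n i.+1) t) - X s| <= eta.
  rewrite distrC ltW// Hd'//= distrC gtr0_norm ?subr_gt0//.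
  have : Num.min (pn n i.+1) t <= pn n i.+1 by rewrite ge_min lexx.
  lra.
have -> : e = (2 * M + 1) * eta by rewrite /eta mulrC divfK// gt_eqF//; lra.
have := normr_ge0 (X s - X (pn n i)).
have := normr_ge0 (X (Num.min (pn n i.+1) t) - X s).
nra.
Qed.

Lemma nondecreasing_scalar_quadratic_limit (pn : nat -> time_partition R) X q :
    locally_vanishing_mesh pn -> cadlag X ->
    (forall t, 0 <= t ->
      (fun n => scalar_quadratic_sum (pn n) X t) @ \oo --> q t) ->
  nondecreasing_path q.
Proof.
move=> mesh cX Xq s t s0; rewrite le_eqVlt => /predU1P[->//|st].
have t0 : 0 <= t by rewrite (le_trans s0)// ltW.
apply/ler_addgt0Pr => e e0.
have Ht : (scalar_quadratic_sum (pn n) X t + e) @[n --> \oo] --> q t + e.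
  by apply: cvgD; [exact: Xq|exact: cvg_cst].
apply: ler_cvg_to (Xq s s0) Ht _.
exact: scalar_quadratic_sum_near_le.
Qed.

End QuadraticSums.

(** * Images of paths, jumps and sums under a continuous linear form *)

Section LinearImage.
Context {R : realType} {G : normedModType R} (f : {linear G -> R^o}).
Hypothesis cf : continuous f.

Lemma cadlag_linear (Q : R -> G) : cadlag Q -> cadlag (f \o Q : R -> R^o).
Proof.
move=> [Qr Ql]; split=> t t0.
  exact: (cvg_comp _ _ (Qr t t0) (cf _)).
apply/cvg_ex; exists (f (lim (Q x @[x --> t^'-]))).
exact: (cvg_comp _ _ (Ql t t0) (cf _)).
Qed.

Lemma jump_linear (Q : R -> G) t : cadlag Q ->
  jump (f \o Q : R -> R^o) t = f (jump Q t).
Proof.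
move=> [_ Ql]; rewrite /jump; case: ifPn => [t0|_]; last by rewrite linear0.
rewrite linearB; congr (_ - _); apply: cvg_lim => //.
exact: (cvg_comp _ _ (Ql t t0) (cf _)).
Qed.

(** Both series are cut at a common index, so [f] is moved through a finite sum. *)
Lemma linear_quadratic_sum (E : normedModType R) (B : {bilinear E -> E -> G})
    (p : time_partition R) (X : R -> E) t :
  (forall x, f (B x x) = `|x| ^+ 2) ->
  f (quadratic_sum B p X t) = scalar_quadratic_sum p X t.
Proof.
move=> fB; rewrite /quadratic_sum /scalar_quadratic_sum.
have norm0 : `|0 : E| ^+ 2 = 0 by rewrite normr0 expr0n.
have [N1 h1] := series_increment_finite G (fun x => B x x) p X t (linear0r _ _).
have [N2 h2] := series_increment_finite R^o (fun x => `|x| ^+ 2) p X t norm0.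
have [_ ->] := h1 (maxn N1 N2) (leq_maxl _ _).
have [_ ->] := h2 (maxn N1 N2) (leq_maxr _ _).
by rewrite linear_sum; apply: eq_bigr => i _; exact: fB.
Qed.

End LinearImage.

Theorem proposition3p6 (R : realType) (H : completeNormedModType R)
    (dot : {dot H for idfun}) (dotE : forall x : H, `|x| ^+ 2 = dot x x)
    (G : completeNormedModType R) (tens : {bilinear H -> H -> G})
    (tensP : completed_projective_tensor tens)
    (X : R -> H) (cadlagX : cadlag X) (pn : nat -> time_partition R)
    (XX : R -> G) (XXP : weak_quadratic_variation tens pn X XX) :
  scalar_quadratic_limit pn X (fun t => tensor_trace dot tens (XX t)) /\
  (locally_vanishing_mesh pn ->
   scalar_quadratic_variation pn X (fun t => tensor_trace dot tens (XX t))).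
Proof.
have [tr_lin tr_cont trE] := tensor_traceP dot dotE tens tensP.
(* [tensor_trace] is a bare function chosen by [get]; its proved linearity is packed to obtain one
   of the forms that test weak convergence. *)
pose lin := GRing.isLinear.Build R G R^o *:%R (tensor_trace dot tens) tr_lin.
pose tr : {linear G -> R^o} := HB.pack (tensor_trace dot tens) lin.
have tr_tens x : tr (tens x x) = `|x| ^+ 2 by rewrite /= trE dotE.
have limX : scalar_quadratic_limit pn X (tr \o XX).
  have [cXX _ XXcvg XXjump] := XXP; split.
  - exact: (cadlag_linear tr).
  - move=> t t0.
    have -> : (fun n => scalar_quadratic_sum (pn n) X t) =
        tr \o (fun n => quadratic_sum tens (pn n) X t).
      by apply/funext => n; rewrite /comp (linear_quadratic_sum tr).
    exact: (weak_space_cvg tr _ _ _ _ _ tr_cont (XXcvg t t0)).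
  - by move=> t t0; rewrite (jump_linear tr)// XXjump.
split=> // mesh; split=> //.
apply: nondecreasing_scalar_quadratic_limit mesh cadlagX _.
exact: sql_cvg limX.
Qed.
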